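(* Let $s\ge 2$ be an integer. For the $s$-node Clenshaw-Curtis collocation method, the Runge-Kutta coefficients $(a_{ij})_{i,j=1}^s$, $(b_j)_{j=1}^s$, $(c_i)_{i=1}^s$ are given, for $i,j=1,\dots,s$, by $$c_i=\frac12\left(1-\cos\left(\frac{(i-1)\pi}{s-1}\right)\right),$$ $$a_{ij}=\frac{1}{2-\delta_{1j}-\delta_{sj}}\cdot\frac{1}{2(s-1)}\sum_{k=1}^{s}{}^{''}\cos\left(\frac{-(k-1)(j-1)\pi}{s-1}\right) I_{i,k-1},$$ $$b_j=a_{sj},$$ where $$I_{i,0}=2c_i,\qquad I_{i,1}=\frac14\left(\cos\frac{-2(i-1)\pi}{s-1}-1\right),$$ and, for $k>1$, $$I_{i,k}=\frac{1}{2(k+1)}\left(\cos\frac{-(k+1)(i-1)\pi}{s-1}+(-1)^k\right)-\frac{1}{2(k-1)}\left(\cos\frac{-(k-1)(i-1)\pi}{s-1}+(-1)^k\right).$$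
   Context: The symbol $\sum_{k=1}^{s}{}^{''}$ means that both the first ($k=1$) and the last ($k=s$) terms of the sum are halved. $\delta_{ij}$ is the Kronecker delta ($1$ if $i=j$, $0$ otherwise). An $s$-node Runge-Kutta method with coefficients $a_{ij},b_j,c_i$ and step size $h$ for the ODE $\dot y=f(t,y)$, with $t_{n+1}=t_n+h$ and $y_n$ the numerical approximation to $y(t_n)$, is $$y_{n+1}=y_n+h\sum_{j=1}^s b_j f(t_n+c_jh,Y_j),\qquad Y_i=y_n+h\sum_{j=1}^s a_{ij}f(t_n+c_jh,Y_j)\quad (i=1,\dots,s).$$ For a positive integer $s$ and distinct real numbers $c_1,\dots,c_s$ (typically between 0 and 1), the collocation method consists of finding the polynomial $u(t_n+\tau h)$ of degree $s$ such that $u(t_n)=y_n$ and $\dot u(t_n+c_ih)=f(t_n+c_ih,u(t_n+c_ih))$ for $i=1,\dots,s$; the numerical solution at $t_{n+1}$ is $y_{n+1}=u(t_n+h)$. For nodes in $[0,1]$ it is a Runge-Kutta method with coefficients $$a_{ij}=\int_0^{c_i} l_j(t)\,dt,\qquad b_j=\int_0^1 l_j(t)\,dt,\qquad l_j(t)=\prod_{k\ne j}\frac{t-c_k}{c_j-c_k}.$$ The $s$-node Clenshaw-Curtis collocation method is the collocation method whose nodes are the Chebyshev points $\xi_i=-\cos\frac{(i-1)\pi}{s-1}$, $i=1,\dots,s$, transplanted from $[-1,1]$ to $[0,1]$, i.e. $c_i=\frac12(1+\xi_i)$.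
   Formalization: The printed formulas fail (s=3: a_11=0, but they give -1/12). Corrected: the prefactor of a_ij is 2-δ_1j-δ_sj, not its reciprocal; in the cosine of a_ij, j-1 becomes s-j; in the cosines of I_{i,k} for k>1, i-1 becomes s-i. *)

(* Defs.v *)
From HB Require Import structures.
From mathcomp Require Import all_boot all_order all_algebra.
From mathcomp Require Import all_classical all_reals all_analysis.
Set Implicit Arguments.
Unset Strict Implicit.
Unset Printing Implicit Defensive.
Import Order.TTheory GRing.Theory Num.Theory.
Import numFieldNormedType.Exports.
Local Open Scope classical_set_scope.
Local Open Scope ring_scope.

(* Node indices are natural numbers 1, ..., s, as in the mathematical notation;
   the values of the functions below at other indices carry no meaning. *)

Definition lagrange_basis (R : realType) (s : nat) (c : nat -> R) (j : nat)
    (t : R) : R :=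
  \prod_(1 <= k < s.+1 | k != j) ((t - c k) / (c j - c k)).

(* The integrals are over the sets [0, c_i] and [0, 1], which agrees with the
   oriented integral from 0 to c_i because the nodes lie in [0, 1]. *)
Definition collocation_a (R : realType) (s : nat) (c : nat -> R) (i j : nat) : R :=
  (\int[lebesgue_measure]_(t in `[0, c i]) lagrange_basis s c j t)%R.

Definition collocation_b (R : realType) (s : nat) (c : nat -> R) (j : nat) : R :=
  (\int[lebesgue_measure]_(t in `[0, 1]) lagrange_basis s c j t)%R.

Definition chebyshev_point (R : realType) (s i : nat) : R :=
  - cos ((i%:R - 1) * pi / (s%:R - 1)).

Definition cc_node (R : realType) (s i : nat) : R :=
  2^-1 * (1 + chebyshev_point R s i).

(* Sum over k = 1, ..., s with the terms k = 1 and k = s halved (s >= 2). *)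
Definition sum_halved_ends (R : realType) (s : nat) (F : nat -> R) : R :=
  \sum_(1 <= k < s.+1) (if (k == 1%N) || (k == s) then F k / 2 else F k).

(* The angle of the i-th Chebyshev point xi_i = - cos ((i - 1) pi / (s - 1))
   is (s - i) pi / (s - 1), so that T_m (xi_i) = cos (m (s - i) pi / (s - 1));
   cc_I s i k is the integral of T_k over [-1, xi_i]. *)
Definition cc_I (R : realType) (s i k : nat) : R :=
  match k with
  | 0 => 2 * cc_node R s i
  | 1 => 4^-1 * (cos (- 2 * (i%:R - 1) * pi / (s%:R - 1)) - 1)
  | _ =>
    1 / (2 * (k%:R + 1)) *
      (cos (- (k%:R + 1) * (s%:R - i%:R) * pi / (s%:R - 1)) + (-1) ^+ k)
    - 1 / (2 * (k%:R - 1)) *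
      (cos (- (k%:R - 1) * (s%:R - i%:R) * pi / (s%:R - 1)) + (-1) ^+ k)
  end.

(* Main.v *)
Require Import Defs.
From HB Require Import structures.
From mathcomp Require Import all_boot all_order all_algebra.
From mathcomp Require Import all_classical all_reals all_analysis.
From mathcomp Require Import ring lra.
Set Implicit Arguments.
Unset Strict Implicit.
Unset Printing Implicit Defensive.
Import Order.TTheory GRing.Theory Num.Theory.
Import numFieldNormedType.Exports.
Local Open Scope ring_scope.

(** The idea is to expand the Lagrange basis in Chebyshev polynomials and to
integrate term by term.  On [-1, 1], with N = s - 1, the Chebyshev points are
xi_i = cos ((s - i) pi / N), and the polynomial

  L_j = (2 - delta_1j - delta_sj) / N * sum'' T_(k-1) (xi_j) T_(k-1),

the sum being over k = 1, ..., s with halved ends, takes the value delta_ij at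
xi_i.  Indeed T_m (cos x) = cos (m x), so at xi_i the halved sum is a trapezoid
sum of products cos (k a pi / N) cos (k b pi / N).  These products are averages
of cos (k m pi / N) for m = a + b and m = a - b, and the trapezoid sum of such
a cosine telescopes after multiplication by 1 - cos (m pi / N): it vanishes
unless 2 N divides m ([trapezoid_cosM], [cardinal_series_point]).

A polynomial of degree below s is determined by its values at s distinct
points, and the transplanted points are distinct because cos is injective on
[0, pi].  Hence the j-th Lagrange polynomial on [0, 1] is L_j (2 t - 1)
([lagrange_basis_cc]).

Finally T_m has the explicit primitive T_(m+1) / (2 (m+1)) - T_(m-1) / (2 (m-1))
for m > 1, by T_(m+1)' = (m+1) U_m and U_m - U_(m-2) = 2 T_m.  Its increment
from -1 to xi_i is I_(i,m) ([cc_IE]), since T_m (-1) = cos (m pi) = (-1)^m, and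
the fundamental theorem of calculus gives a_ij, the change of variable 2 t - 1
contributing a factor 1/2.  For b_j, the last node is 1. *)

(** * Chebyshev polynomials and their antiderivatives *)

Section Chebyshev.
Variable R : realType.

Fixpoint chebyshevT (n : nat) : {poly R} :=
  match n with
  | 0 => 1
  | 1 => 'X
  | (m.+1 as m1).+1 => 2 * 'X * chebyshevT m1 - chebyshevT m
  end.

Fixpoint chebyshevU (n : nat) : {poly R} :=
  match n with
  | 0 => 1
  | 1 => 2 * 'X
  | (m.+1 as m1).+1 => 2 * 'X * chebyshevU m1 - chebyshevU m
  end.

Lemma chebyshevTSS n :
  chebyshevT n.+2 = 2 * 'X * chebyshevT n.+1 - chebyshevT n.
Proof. by []. Qed.

Lemma chebyshevUSS n :
  chebyshevU n.+2 = 2 * 'X * chebyshevU n.+1 - chebyshevU n.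
Proof. by []. Qed.

Lemma nat_ind2 (P : nat -> Prop) :
  P 0 -> P 1 -> (forall n, P n -> P n.+1 -> P n.+2) -> forall n, P n.
Proof.
move=> P0 P1 PSS n; suff [] : P n /\ P n.+1 by [].
by elim: n => [|n [Pn PSn]]; split=> //; exact: PSS.
Qed.

Lemma size_chebyshevT n : (size (chebyshevT n) <= n.+1)%N.
Proof.
elim/nat_ind2: n => [||n IHn IHSn]; rewrite ?size_poly1 ?size_polyX//.
rewrite chebyshevTSS (leq_trans (size_polyD _ _))// geq_max size_polyN.
rewrite (leq_trans IHn) ?andbT; last by rewrite ltnW.
rewrite -mulrA mulr_natl -scaler_nat (leq_trans (size_scale_leq _ _))//.
by rewrite (leq_trans (size_polyMleq _ _))// size_polyX.
Qed.

Lemma chebyshevT_cos n (x : R) : (chebyshevT n).[cos x] = cos (n%:R * x).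
Proof.
elim/nat_ind2: n => [||n IHn IHSn].
- by rewrite mul0r cos0 hornerE.
- by rewrite mul1r hornerX.
rewrite chebyshevTSS !(hornerE, hornerMn) IHn IHSn.
have -> : n.+2%:R * x = n.+1%:R * x + x by rewrite -[in LHS]natr1 mulrDl mul1r.
have -> : n%:R * x = n.+1%:R * x - x.
  by rewrite -[in RHS]natr1 mulrDl mul1r addrK.
by rewrite !cosD cosN sinN; ring.
Qed.

(** Both sides satisfy the Chebyshev recurrence, which is linear, so it is
enough to compare them for two consecutive indices. *)
Lemma chebyshevUB n :
  chebyshevU n.+2 - chebyshevU n = 2 * chebyshevT n.+2.
Proof.
elim/nat_ind2: n => [||n IHn IHSn].
- by rewrite /=; ring.
- by rewrite /=; ring.
transitivity (2 * 'X * (2 * chebyshevT n.+3) - 2 * chebyshevT n.+2).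
  by rewrite -IHSn -IHn (chebyshevUSS n.+2) (chebyshevUSS n); ring.
by rewrite (chebyshevTSS n.+2); ring.
Qed.

Lemma deriv_chebyshevT n : (chebyshevT n.+1)^`() = n.+1%:R *: chebyshevU n.
Proof.
elim/nat_ind2: n => [||n IHn IHSn].
- by rewrite derivX scale1r.
- by rewrite /= !poly.derivE scaler_nat; ring.
rewrite chebyshevTSS derivB IHn derivM IHSn !poly.derivE !scaler_nat.
rewrite addr0 mul0r add0r mulr1 -chebyshevUB chebyshevUSS.
by ring.
Qed.

(** The general formula has T_(n-1) / (2 (n-1)) as its second term, which makes
no sense for n = 0 and n = 1. *)
Definition chebyshev_primitive (n : nat) : {poly R} :=
  match n with
  | 0 => 'X
  | 1 => 2^-1 *: 'X^2
  | m.+1 => (2 * n.+1%:R)^-1 *: chebyshevT n.+1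
            - (2 * m%:R)^-1 *: chebyshevT m
  end.

Lemma deriv_chebyshev_primitive n :
  (chebyshev_primitive n)^`() = chebyshevT n.
Proof.
case: n => [|[|n]].
- by rewrite derivX.
- rewrite /= derivZ derivXn -[X in _ *: X]scaler_nat scalerA.
  by rewrite mulVf ?pnatr_eq0// scale1r.
rewrite derivB !derivZ !deriv_chebyshevT !scalerA !invfM !mulfVK ?pnatr_eq0//.
rewrite -scalerBr chebyshevUB mulr_natl -[X in _ *: X]scaler_nat scalerA.
by rewrite mulVf ?pnatr_eq0// scale1r.
Qed.
End Chebyshev.

(** * Discrete orthogonality at the Chebyshev points *)

Section Orthogonality.
Variable R : realType.

Lemma cos_natpi n : cos (n%:R * pi) = (-1) ^+ n :> R.
Proof.
rewrite mulr_natl; have := alternatingn (@cosDpi R) n 0.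
by rewrite add0r cos0 mulr1.
Qed.

Lemma sin_natpi n : sin (n%:R * pi) = 0 :> R.
Proof.
rewrite mulr_natl; have := alternatingn (@sinDpi R) n 0.
by rewrite add0r sin0 mulr0.
Qed.

Lemma cos_neq1 (x : R) : 0 < x < pi *+ 2 -> cos x != 1.
Proof.
move=> /andP[x0 x2pi].
have sx : 0 < sin (x / 2) by apply: sin_gt0_pi; lra.
have := cos2Dsin2 (x / 2); have := cosD (x / 2) (x / 2).
have -> : x / 2 + x / 2 = x by lra.
move=> -> h; apply/eqP => h'; have : sin (x / 2) ^+ 2 = 0 by lra.
by move/eqP; rewrite sqrf_eq0 gt_eqF.
Qed.

(** Each term telescopes: (1 - cos x) (cos y + cos (x + y)) equals
sin x (sin (x + y) - sin y). *)
Lemma mul_trapezoid_cos (N : nat) (x : R) :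
  (1 - cos x) * \sum_(k < N) (cos (k%:R * x) + cos (k.+1%:R * x)) =
  sin x * sin (N%:R * x).
Proof.
elim: N => [|N IHN]; first by rewrite big_ord0 mul0r sin0 !mulr0.
have SNx : N.+1%:R * x = N%:R * x + x by rewrite -natr1 mulrDl mul1r.
rewrite big_ord_recr /= mulrDr IHN SNx cosD sinD.
have s2 : sin x ^+ 2 = 1 - cos x ^+ 2 by rewrite -(cos2Dsin2 x) addrC addKr.
by ring: s2.
Qed.

(** With x = m pi / N, the right-hand side of [mul_trapezoid_cos] has the factor
sin (m pi) = 0, while the range of m keeps cos x away from 1. *)
Lemma trapezoid_cos_eq0 (N m : nat) : (0 < m < N.*2)%N ->
  \sum_(k < N) (cos (k%:R * (m%:R * (pi / N%:R))) +
                cos (k.+1%:R * (m%:R * (pi / N%:R)))) = 0 :> R.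
Proof.
move=> /andP[m0 m2N]; set x := m%:R * (pi / N%:R).
have N0 : (0 < N)%N by rewrite -double_gt0 (leq_ltn_trans _ m2N).
have N0' : N%:R != 0 :> R by rewrite pnatr_eq0 -lt0n.
have xE : N%:R * x = m%:R * pi by rewrite /x; field.
have cx : cos x != 1.
  apply: cos_neq1; rewrite /x !mulr_gt0 ?invr_gt0 ?ltr0n ?pi_gt0//=.
  rewrite mulrCA -[pi *+ 2]mulr_natr ltr_pM2l ?pi_gt0// ltr_pdivrMr ?ltr0n//.
  by rewrite -natrM ltr_nat mul2n.
apply/eqP; move: (mul_trapezoid_cos N x); rewrite xE sin_natpi mulr0.
by move=> /eqP; rewrite mulf_eq0 subr_eq0 eq_sym (negbTE cx).
Qed.

Lemma trapezoid_cos_full (N : nat) (x : R) :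
  (forall k : nat, cos (k%:R * x) = 1) ->
  \sum_(k < N) (cos (k%:R * x) + cos (k.+1%:R * x)) = N%:R *+ 2.
Proof.
move=> x1; under eq_bigr do rewrite !x1.
by rewrite sumr_const card_ord -mulrnA mulnC mulrnA.
Qed.

(** Discrete orthogonality of the Chebyshev polynomials at their extrema.  The
product is the average of the cosines for a + b and a - b; both indices lie
in [0, 2N], and of the trapezoid sums only those for 0 and 2N survive. *)
Lemma trapezoid_cosM (N a b : nat) : (0 < N)%N -> (a <= N)%N -> (b <= N)%N ->
  let G k := cos (k%:R * (a%:R * (pi / N%:R))) *
             cos (k%:R * (b%:R * (pi / N%:R))) in
  2^-1 * \sum_(k < N) (G k + G k.+1) =
  if a != b then 0 else if (a == 0) || (a == N) then N%:R else N%:R / 2 :> R.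
Proof.
move=> N0; wlog ba : a b / (b <= a)%N => [hw|].
  move=> aN bN; have [/hw|/ltnW/hw h] := leqP b a; first exact.
  move=> G; apply: etrans (etrans (h bN aN) _); last first.
    by rewrite eq_sym; case: eqVneq => // ->.
  by congr (_ * _); apply: eq_bigr => k _; congr (_ + _); exact: mulrC.
move=> aN bN; set t := pi / N%:R => G.
have N0' : N%:R != 0 :> R by rewrite pnatr_eq0 -lt0n.
pose S m : R :=
  \sum_(k < N) (cos (k%:R * (m%:R * t)) + cos (k.+1%:R * (m%:R * t))).
have -> : \sum_(k < N) (G k + G k.+1) = 2^-1 * (S (a + b)%N + S (a - b)%N).
  rewrite /S -big_split mulr_sumr; apply: eq_bigr => k _ /=.
  rewrite natrD natrB// /G !(mulrDl, mulrDr, mulNr, mulrN) !cosD !cosN !sinN.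
  by field.
have S0 : S 0 = N%:R *+ 2.
  by apply: trapezoid_cos_full => // k; rewrite mul0r mulr0 cos0.
case: eqVneq => [eab|nab] /=.
  rewrite -eab subnn S0 addnn.
  have [->|a0] /= := eqVneq a 0; first by rewrite S0; field.
  have [->|aN'] /= := eqVneq a N.
    rewrite /S trapezoid_cos_full//; first by field.
    move=> k; have -> : k%:R * ((N.*2)%:R * t) = (k.*2)%:R * pi.
      by rewrite -!muln2 !natrM /t; field.
    by rewrite cos_natpi -mul2n exprM sqrrN expr1n expr1n.
  rewrite /S trapezoid_cos_eq0 ?add0r; first by field.
  by rewrite double_gt0 lt0n a0 ltn_double ltn_neqAle aN' aN.
rewrite /S !trapezoid_cos_eq0 ?addr0 ?mulr0//.
all: have ba' : (b < a)%N by rewrite ltn_neqAle eq_sym nab.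
  rewrite subn_gt0 ba' -addnn (leq_ltn_trans (leq_subr _ _))//.
  by rewrite (leq_ltn_trans aN)// -addn1 leq_add2l.
rewrite addn_gt0 (leq_ltn_trans _ ba')//= -addnn -addnS.
by rewrite leq_add// (leq_trans ba').
Qed.
End Orthogonality.

(** Interior terms occur in two consecutive trapezoids, end terms in one. *)
Lemma sum_halved_ends_trapezoid (R : realType) (N : nat) (F : nat -> R) :
  (0 < N)%N ->
  sum_halved_ends N.+1 F = 2^-1 * \sum_(k < N) (F k.+1 + F k.+2).
Proof.
case: N => // N _; rewrite big_split /= big_ord_recl big_ord_recr /=.
rewrite /sum_halved_ends big_ltn// big_nat_recr//= eqxx.
rewrite (_ : \big[_/_]_(2 <= i < _) _ = \sum_(i < N) F i.+2).
  by under eq_bigr do rewrite /bump /=; field.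
rewrite -(big_mkord xpredT (fun i => F i.+2)) (big_addn 0 N.+2 2) subn2.
rewrite !big_nat; apply: eq_bigr => k /andP[_ kN].
by rewrite addn2 /= !eqSS ltn_eqF.
Qed.

(** * Lagrange basis and integrals of polynomials *)

(** Two polynomials of degree below s that agree at s distinct points are
equal, and the Lagrange basis function is one of them. *)
Lemma lagrange_basis_unique (R : realType) (s : nat) (c : nat -> R) (j : nat)
    (p : {poly R}) (t : R) :
  {in [pred k | 1 <= k <= s]%N &, injective c} -> (1 <= j <= s)%N ->
  (size p <= s)%N ->
  (forall k, (1 <= k <= s)%N -> p.[c k] = (k == j)%:R) ->
  lagrange_basis s c j t = p.[t].
Proof.
move=> c_inj js sp pc.
pose q : {poly R} := \prod_(1 <= k < s.+1 | k != j)
  ((c j - c k)^-1 *: ('X - (c k)%:P)).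
have qE x : q.[x] = lagrange_basis s c j x.
  rewrite horner_prod; apply: eq_bigr => k _.
  by rewrite hornerZ hornerXsubC mulrC.
have sq : (size q <= s)%N.
  have -> : q = (\prod_(1 <= k < s.+1 | k != j) (c j - c k)^-1) *:
      \prod_(k <- [seq c k | k <- index_iota 1 s.+1 & k != j]) ('X - k%:P).
    by rewrite big_map big_filter -scaler_prod.
  rewrite (leq_trans (size_scale_leq _ _))// size_prod_XsubC size_map.
  rewrite -rem_filter ?iota_uniq// size_rem ?size_iota ?mem_index_iota//.
  by rewrite subSS subn0 prednK//; case/andP: js; exact: leq_trans.
rewrite -qE; congr (_.[t]); apply/eqP; rewrite -subr_eq0; apply/eqP.
apply: (@roots_geq_poly_eq0 _ _ [seq c k | k <- index_iota 1 s.+1]).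
- apply/allP => x /mapP[k]; rewrite mem_index_iota ltnS => ks {x}->.
  rewrite rootE hornerD hornerN pc// qE subr_eq0; apply/eqP.
  rewrite /lagrange_basis; case: eqVneq => [->|kj].
    rewrite big_nat_cond; apply: big1 => l /andP[ls lj].
    rewrite divff// subr_eq0; apply/eqP => /c_inj jl.
    by move: lj; rewrite jl ?eqxx.
  rewrite (big_rem k) ?mem_index_iota//= kj.
  by rewrite subrr !mul0r.
- rewrite map_inj_in_uniq ?iota_uniq// => x y.
  by rewrite !mem_index_iota !ltnS; exact: c_inj.
- rewrite size_map size_iota subSS subn0 (leq_trans (size_polyD _ _))//.
  by rewrite geq_max size_polyN sq.
Qed.

Lemma Rintegral_deriv_horner (R : realType) (P : {poly R}) (a b : R) :
  a <= b ->
  (\int[lebesgue_measure]_(t in `[a, b]) P^`().[t])%R = P.[b] - P.[a].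
Proof.
rewrite le_eqVlt => /predU1P[->|ab].
  by rewrite set_itv1 Rintegral_set1 subrr.
rewrite /Rintegral (@continuous_FTC2 _ _ (horner P))//.
- exact/continuous_subspaceT/continuous_horner.
- split; first by move=> x _; exact: derivable_horner.
    by apply: cvg_at_right_filter; exact: continuous_horner.
  by apply: cvg_at_left_filter; exact: continuous_horner.
- by move=> x _; rewrite derivE.
Qed.

(** * The Clenshaw-Curtis nodes *)

Section ClenshawCurtis.
Variables (R : realType) (s : nat).
Hypothesis s_ge2 : (2 <= s)%N.

Let N := s.-1.
Let N_gt0 : (0 < N)%N. Proof. by rewrite /N -ltnS prednK ?(ltnW s_ge2). Qed.
Let sE : s = N.+1. Proof. by rewrite /N prednK ?(ltnW s_ge2). Qed.
Let sB1 : s%:R - 1 = N%:R :> R. Proof. by rewrite sE -natr1 addrK. Qed.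
Let N_neq0 : N%:R != 0 :> R. Proof. by rewrite pnatr_eq0 -lt0n. Qed.
Let xi := chebyshev_point R s.

(** Measuring the angle from s turns the minus sign of the definition into
the supplement of the angle; for i = 1, ..., s it ranges over [0, pi]. *)
Lemma chebyshev_point_cos i :
  (i <= s)%N -> xi i = cos ((s - i)%:R * (pi / N%:R)).
Proof.
move=> le_is; rewrite /xi /chebyshev_point sB1.
rewrite -[in LHS]cosN -cosDpi natrB// sE -natr1; congr cos.
by field.
Qed.

Lemma chebyshevT_point n i : (i <= s)%N ->
  (chebyshevT R n).[xi i] = cos (- n%:R * (s%:R - i%:R) * pi / (s%:R - 1)).
Proof.
move=> le_is; rewrite chebyshev_point_cos// chebyshevT_cos natrB// sB1.
by rewrite -[in LHS]cosN; congr cos; field.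
Qed.

Lemma chebyshev_point_inj : {in [pred k | 1 <= k <= s]%N &, injective xi}.
Proof.
move=> k l /andP[k1 ks] /andP[l1 ls].
have in0pi m : (1 <= m)%N -> (s - m)%:R * (pi / N%:R) \in `[0, pi : R].
  move=> m1; rewrite in_itv /= !mulr_ge0 ?invr_ge0 ?pi_ge0//=.
  rewrite mulrCA ler_piMr ?pi_ge0// ler_pdivrMr ?ltr0n// mul1r ler_nat.
  by rewrite sE leq_subLR -addn1 addnC leq_add.
rewrite !chebyshev_point_cos// => /(cos_inj (in0pi _ k1) (in0pi _ l1)).
move/(mulIf _) => h; have /eqP : (s - k)%:R = (s - l)%:R :> R.
  by apply: h; rewrite mulf_neq0 ?invr_eq0// gt_eqF ?pi_gt0.
by rewrite eqr_nat eqn_sub2lE// => /eqP.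
Qed.

Lemma cc_node_inj : {in [pred k | 1 <= k <= s]%N &, injective (cc_node R s)}.
Proof.
move=> k l ks ls h; apply: chebyshev_point_inj => //.
by move: h; rewrite /cc_node -/xi; lra.
Qed.

Lemma cc_IE i k : (1 <= i <= s)%N ->
  (chebyshev_primitive R k).[xi i] - (chebyshev_primitive R k).[-1] =
  cc_I R s i k.
Proof.
move=> /andP[i1 le_is]; case: k => [|[|k]].
- by rewrite !hornerX /cc_I /cc_node -/xi; field.
- rewrite /cc_I !hornerZ !hornerXn /xi /chebyshev_point.
  set y := (i%:R - 1) * pi / (s%:R - 1).
  have -> : - 2 * (i%:R - 1) * pi / (s%:R - 1) = - (y + y) by rewrite /y; ring.
  have s2 : sin y ^+ 2 = 1 - cos y ^+ 2 by rewrite -(cos2Dsin2 y) addrC addKr.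
  by rewrite cosN cosD; field: s2.
have primE x : (chebyshev_primitive R k.+2).[x] =
    (2 * k.+3%:R)^-1 * (chebyshevT R k.+3).[x]
    - (2 * k.+1%:R)^-1 * (chebyshevT R k.+1).[x].
  by rewrite hornerD hornerN 2!hornerZ.
rewrite -cospi !primE.
rewrite !chebyshevT_cos !cos_natpi !chebyshevT_point//.
rewrite /cc_I !natr1.
have -> : k.+2%:R - 1 = k.+1%:R :> R by rewrite -natr1 addrK.
rewrite !exprS.
have : k.+3%:R != 0 :> R by rewrite pnatr_eq0.
have : k.+1%:R != 0 :> R by rewrite pnatr_eq0.
move: (cos _) => C; move: (cos _) => D; move: ((-1) ^+ k) => e.
move: k.+1%:R k.+3%:R => a b a0 b0.
by field; rewrite a0 b0.
Qed.

(** * The cardinal functions as Chebyshev series *)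

Definition cardinal_weight (j : nat) : R :=
  (2 - (j == 1%N)%:R - (j == s)%:R) / (s%:R - 1).

Definition cardinal_coef (j k : nat) : R :=
  cardinal_weight j * ((if (k == 1%N) || (k == s) then 2^-1 else 1) *
    cos (- (k%:R - 1) * (s%:R - j%:R) * pi / (s%:R - 1))).

(** For F = T this is the j-th cardinal function of the Chebyshev points, the
coefficients being T_(k-1) (xi_j) up to the weights.  Leaving F free lets the
same sum over primitives of the T_n serve as a primitive of that function. *)
Definition cardinal_series (F : nat -> {poly R}) (j : nat) : {poly R} :=
  \sum_(1 <= k < s.+1) cardinal_coef j k *: F (k - 1)%N.

Lemma weighted_sum_halved_ends j (G : nat -> R) :
  cardinal_weight j * sum_halved_ends s (fun k =>
      cos (- (k%:R - 1) * (s%:R - j%:R) * pi / (s%:R - 1)) * G (k - 1)%N) =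
  \sum_(1 <= k < s.+1) cardinal_coef j k * G (k - 1)%N.
Proof.
rewrite mulr_sumr; apply: eq_bigr => k _; rewrite /cardinal_coef.
by case: ifP => _; field.
Qed.

Lemma horner_cardinal_series F j x : (cardinal_series F j).[x] =
  \sum_(1 <= k < s.+1) cardinal_coef j k * (F (k - 1)%N).[x].
Proof. by rewrite horner_sum; apply: eq_bigr => k _; rewrite hornerZ. Qed.

Lemma deriv_cardinal_series F j :
  (cardinal_series F j)^`() = cardinal_series (fun n => (F n)^`()) j.
Proof. by rewrite raddf_sum; apply: eq_bigr => k _; exact: derivZ. Qed.

Lemma size_cardinal_series j : (size (cardinal_series (chebyshevT R) j) <= s)%N.
Proof.
rewrite /cardinal_series big_nat.
elim/big_ind: _ => [|p q sp sq|k /andP[k1 ks]]; first by rewrite size_poly0.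
  by rewrite (leq_trans (size_polyD _ _))// geq_max sp.
rewrite (leq_trans (size_scale_leq _ _))// (leq_trans (size_chebyshevT _ _))//.
by rewrite subn1 prednK.
Qed.

(** The value of the orthogonality sum is N at the two end indices and N / 2 at
the others, which is what the factor 2 - delta_1j - delta_sj compensates. *)
Lemma cardinal_series_point i j : (1 <= i <= s)%N -> (1 <= j <= s)%N ->
  (cardinal_series (chebyshevT R) j).[xi i] = (i == j)%:R.
Proof.
move=> /andP[i1 le_is] /andP[j1 le_js].
rewrite horner_cardinal_series.
rewrite -(weighted_sum_halved_ends _ (fun n => (chebyshevT R n).[xi i])).
pose G k := cos (k%:R * ((s - i)%:R * (pi / N%:R))) *
  cos (k%:R * ((s - j)%:R * (pi / N%:R))) : R.
have bound m : (1 <= m)%N -> (s - m <= N)%N.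
  by move=> m1; rewrite sE leq_subLR -addn1 addnC leq_add.
transitivity (cardinal_weight j * (2^-1 * \sum_(k < N) (G k + G k.+1))).
  rewrite [in sum_halved_ends s]sE sum_halved_ends_trapezoid//.
  suff FG k : cos (- (k.+1%:R - 1) * (s%:R - j%:R) * pi / (s%:R - 1)) *
      (chebyshevT R (k.+1 - 1)%N).[xi i] = G k.
    by congr (_ * (_ * _)); apply: eq_bigr => k _; rewrite !FG.
  rewrite subn1 -natr1 addrK -chebyshevT_point// !chebyshev_point_cos//.
  by rewrite !chebyshevT_cos mulrC.
rewrite trapezoid_cosM ?bound// eqn_sub2lE//.
have [<-|] := eqVneq i j; rewrite /= ?mulr0//.
have -> : (s - i == 0)%N = (i == s) by rewrite subn_eq0 eqn_leq le_is.
have -> : (s - i == N)%N = (i == 1%N).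
  by rewrite /N -subn1 eqn_sub2lE// ltnW.
rewrite /cardinal_weight sB1; have [->|] := eqVneq i s.
  rewrite (gtn_eqF s_ge2) /=; by field.
by move=> _; case: (eqVneq i 1%N) => _ /=; field.
Qed.

Lemma lagrange_basis_cc j t : (1 <= j <= s)%N ->
  lagrange_basis s (cc_node R s) j t =
  (cardinal_series (chebyshevT R) j).[2 * t - 1].
Proof.
move=> js; pose A : {poly R} := 2 *: 'X - 1.
have hA x : A.[x] = 2 * x - 1 by rewrite !hornerE.
rewrite -hA -horner_comp; apply: lagrange_basis_unique => //.
- exact: cc_node_inj.
- rewrite (leq_trans (size_comp_poly_leq _ _))//.
  have sA : ((size A).-1 <= 1)%N.
    rewrite -subn1 leq_subLR (leq_trans (size_polyD _ _))// geq_max size_polyN.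
    by rewrite size_poly1 (leq_trans (size_scale_leq _ _))// size_polyX.
  apply: leq_ltn_trans (leq_mul (leqnn _) sA) _; rewrite muln1.
  have := size_cardinal_series j; case: (size _) => [_|//].
  exact: ltnW.
move=> k ks; rewrite horner_comp hA.
have -> : 2 * cc_node R s k - 1 = xi k by rewrite /cc_node -/xi; field.
exact: cardinal_series_point.
Qed.
End ClenshawCurtis.

Theorem theorem1 (R : realType) (s : nat) (hs : (2 <= s)%N)
    (i j : nat) (hi : (1 <= i <= s)%N) (hj : (1 <= j <= s)%N) :
  [/\ cc_node R s i = 2^-1 * (1 - cos ((i%:R - 1) * pi / (s%:R - 1))),
      collocation_a s (cc_node R s) i j =
        (2 - (j == 1%N)%:R - (j == s)%:R) * (1 / (2 * (s%:R - 1))) *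
        sum_halved_ends s (fun k =>
          cos (- (k%:R - 1) * (s%:R - j%:R) * pi / (s%:R - 1)) *
          cc_I R s i (k - 1)) &
      collocation_b s (cc_node R s) j = collocation_a s (cc_node R s) s j].
Proof.
have s0 : (0 < s)%N by exact: ltnW.
have sB1 : s%:R - 1 != 0 :> R by rewrite subr_eq0 pnatr_eq1 gtn_eqF.
have node_s : cc_node R s s = 1.
  by rewrite /cc_node /chebyshev_point mulrAC divff// mul1r cospi; field.
split; first by [].
  pose A : {poly R} := 2 *: 'X - 1.
  have hA x : A.[x] = 2 * x - 1 by rewrite !hornerE.
  (* The factor 1/2 undoes the derivative 2 of t |-> 2 t - 1. *)
  pose P := 2^-1 *: (cardinal_series s (chebyshev_primitive R) j \Po A).
  have dP t : lagrange_basis s (cc_node R s) j t = P^`().[t].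
    rewrite lagrange_basis_cc// derivZ deriv_comp deriv_cardinal_series.
    have -> : A^`() = 2%:P.
      by rewrite derivB derivZ derivX derivC subr0 alg_polyC.
    rewrite hornerZ hornerM horner_comp hA hornerC.
    rewrite (_ : cardinal_series _ _ _ = cardinal_series s (chebyshevT R) j).
      by field.
    by apply: eq_bigr => k _; rewrite deriv_chebyshev_primitive.
  rewrite /collocation_a; under eq_Rintegral do rewrite dP.
  rewrite Rintegral_deriv_horner.
    rewrite !hornerZ !horner_comp !hA mulr0 sub0r.
    have -> : 2 * cc_node R s i - 1 = chebyshev_point R s i.
      by rewrite /cc_node; field.
    rewrite !horner_cardinal_series -mulrBr -sumrB.
    under eq_bigr do rewrite -mulrBr cc_IE//.
    rewrite -weighted_sum_halved_ends mulrA; congr (_ * _).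
    by rewrite /cardinal_weight; field.
  by rewrite /cc_node /chebyshev_point mulr_ge0// subr_ge0 cos_le1.
by rewrite /collocation_a /collocation_b node_s.
Qed.
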